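(* For every integer $N \geq 1$, there exists a constant $C = C(N)$ (depending only on $N$) such that for all $1 < p < \infty$ and all $u \in C^\infty_c(\mathbb{R}^N)$, $$\left[ \frac{u(x) - u(y)}{|x-y|^{\frac{N+1}{p}}} \right]_{M^p(\mathbb{R}^N \times \mathbb{R}^N)} \leq C \, \|u\|_{L^\infty(\mathbb{R}^N)}^{1 - 1/p} \, \|\nabla u\|_{L^1(\mathbb{R}^N)}^{1/p}.$$
   Context: $C^\infty_c(\mathbb{R}^N)$ is the space of (real-valued) smooth compactly supported functions on $\mathbb{R}^N$, and $\|\nabla u\|_{L^1(\mathbb{R}^N)} = \int_{\mathbb{R}^N} |\nabla u(x)| \, dx$ with $|\cdot|$ the Euclidean norm. For $1 \le p < \infty$, the Marcinkiewicz (weak $L^p$) quasi-norm of a measurable function $f$ on $\mathbb{R}^N \times \mathbb{R}^N$ is defined by $$[f]_{M^p(\mathbb{R}^N \times \mathbb{R}^N)}^p := \sup_{\lambda > 0} \lambda^p \, \mathcal{L}^{2N}\bigl(\{ (x,y) \in \mathbb{R}^N \times \mathbb{R}^N : |f(x,y)| \geq \lambda \}\bigr),$$ where $\mathcal{L}^{2N}$ is Lebesgue measure on $\mathbb{R}^N \times \mathbb{R}^N$. The quotient in the claim is regarded as a function of $(x,y)$ defined for $x \neq y$ (the diagonal has measure zero). *)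

(* Defs.v *)
From HB Require Import structures.
From mathcomp Require Import all_boot all_order all_algebra.
From mathcomp Require Import all_classical all_reals all_analysis.

Set Implicit Arguments.
Unset Strict Implicit.
Unset Printing Implicit Defensive.

Import Order.TTheory GRing.Theory Num.Theory.
Import numFieldNormedType.Exports.

Local Open Scope classical_set_scope.
Local Open Scope ring_scope.

Definition measure_rV_display : measure_display -> measure_display.
Proof. exact. Qed.

(* 'rV[R]_n carries the sigma-algebra generated by the coordinates (as
   n.-tuple T does in the library), which is the Borel sigma-algebra. *)
Section measurable_rV.
Context {R : realType}.
Variable n : nat.

Definition rV_coord (i : 'I_n) (x : 'rV[R]_n) : measurableTypeR R := x ord0 i.

Let rV_set0 : g_sigma_preimage rV_coord set0.
Proof. exact: sigma_algebra0. Qed.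

Let rV_setC A : g_sigma_preimage rV_coord A -> g_sigma_preimage rV_coord (~` A).
Proof. exact: sigma_algebraC. Qed.

Let rV_bigcup (F : _^nat) : (forall i, g_sigma_preimage rV_coord (F i)) ->
  g_sigma_preimage rV_coord (\bigcup_i (F i)).
Proof. exact: sigma_algebra_bigcup. Qed.

HB.instance Definition _ := @isMeasurable.Build
  (measure_rV_display default_measure_display)
  'rV[R]_n (g_sigma_preimage rV_coord) rV_set0 rV_setC rV_bigcup.

Lemma measurable_rV_coord (i : 'I_n) : measurable_fun [set: 'rV[R]_n] (rV_coord i).
Proof.
move=> _ Y mY; rewrite setTI; apply: sub_sigma_algebra => /=.
rewrite -bigcup_seq/=; exists i => /=; first by rewrite mem_index_enum.
by exists Y => //; rewrite setTI.
Qed.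

Lemma measurable_fun_rV d (T : measurableType d) (f : T -> 'rV[R]_n) :
  (forall i, measurable_fun [set: T] (rV_coord i \o f)) ->
  measurable_fun [set: T] f.
Proof.
move=> mf _ A mA; rewrite setTI.
pose G : set (set 'rV[R]_n) := [set B | measurable (f @^-1` B)].
have sG : sigma_algebra setT G.
  split; rewrite /G /=.
  - by rewrite preimage_set0.
  - by move=> B mB; rewrite setTD preimage_setC; exact: measurableC.
  - by move=> F mF; rewrite preimage_bigcup; exact: bigcupT_measurable.
apply: (mA G); split => // B.
rewrite -bigcup_seq/= => -[i _ [C mC <-]].
by rewrite /G /= setTI; have := mf i measurableT C mC; rewrite setTI.
Qed.

End measurable_rV.

(* The corresponding library instance on m1 \x m2 is not inferred by
   unification. *)
Lemma sigma_finite_prod d1 d2 (T1 : measurableType d1) (T2 : measurableType d2)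
    (R : realType) (m1 : {sigma_finite_measure set T1 -> \bar R})
    (m2 : {sigma_finite_measure set T2 -> \bar R}) :
  sigma_finite setT (m1 \x m2)%E.
Proof.
have /sigma_finiteP[F [TF ndF Foo]] := sigma_finiteT m1.
have /sigma_finiteP[G [TG ndG Goo]] := sigma_finiteT m2.
exists (fun n => F n `*` G n).
  rewrite -setXTT TF TG predeqE => -[x y]; split.
    move=> [/= [n _ Fnx] [k _ Gky]]; exists (maxn n k) => //; split.
    - by move: x Fnx; exact/subsetPset/ndF/leq_maxl.
    - by move: y Gky; exact/subsetPset/ndG/leq_maxr.
  by move=> [n _ []/= ? ?]; split; exists n.
move=> k; have [? ?] := Foo k; have [? ?] := Goo k.
split; first exact: measurableX.
by rewrite product_measure1E// lte_mul_pinfty// ge0_fin_numE.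
Qed.

Section lebesgue_rV.
Context {R : realType}.

Definition rV_cons n (z : measurableTypeR R * 'rV[R]_n) : 'rV[R]_n.+1 :=
  row_mx (const_mx z.1 : 'rV_1) z.2.

Definition rV_uncons n (x : 'rV[R]_n.+1) : measurableTypeR R * 'rV[R]_n :=
  (x ord0 ord0, rsubmx (x : 'rV_(1 + n))).

Lemma rV_consK n : cancel (@rV_cons n) (@rV_uncons n).
Proof.
move=> [t v]; rewrite /rV_uncons /rV_cons /= row_mxKr; congr (_, _).
transitivity (row_mx (const_mx t : 'rV_1) v ord0 (lshift n ord0)).
  by congr (row_mx _ _ _ _); exact/val_inj.
by rewrite row_mxEl mxE.
Qed.

Lemma rV_cons_ord0 n t (v : 'rV[R]_n) : rV_cons (t, v) ord0 ord0 = t.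
Proof. by have [] := rV_consK (t, v). Qed.

Lemma rV_cons_lift n t (v : 'rV[R]_n) i :
  rV_cons (t, v) ord0 (lift ord0 i) = v ord0 i.
Proof.
rewrite -(row_mxEr (const_mx t : 'rV_1) v ord0 i).
by congr (row_mx _ _ _ _); exact/val_inj.
Qed.

Lemma measurable_rV_cons n : measurable_fun setT (@rV_cons n).
Proof.
apply: measurable_fun_rV => i; case: (unliftP ord0 i) => [j ->|->].
- rewrite (_ : _ \o _ = @rV_coord R n j \o snd); last first.
    by apply/funext => -[t v]; rewrite /= /rV_coord rV_cons_lift.
  by apply: measurableT_comp => //; exact: measurable_rV_coord.
- rewrite (_ : _ \o _ = fst)//.
  by apply/funext => -[t v]; rewrite /= /rV_coord rV_cons_ord0.
Qed.

Lemma measurable_rV_uncons n : measurable_fun setT (@rV_uncons n).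
Proof.
apply/measurable_fun_pairP; split.
- exact: (@measurable_rV_coord R n.+1 ord0).
- apply: measurable_fun_rV => i.
  rewrite (_ : _ \o _ = @rV_coord R n.+1 (lift ord0 i)).
    exact: measurable_rV_coord.
  apply/funext => x; rewrite /= /rV_coord mxE; congr (x _ _).
  exact/val_inj.
Qed.

Section step.
Variables (n : nat) (mu : {sigma_finite_measure set 'rV[R]_n -> \bar R}).

Definition lebesgue_rV_step : set 'rV[R]_n.+1 -> \bar R :=
  pushforward (@lebesgue_measure R \x mu)%E (@rV_cons n).

Let step0 : lebesgue_rV_step set0 = 0%E.
Proof. by rewrite /lebesgue_rV_step /pushforward preimage_set0 measure0. Qed.

Let step_ge0 A : (0 <= lebesgue_rV_step A)%E.
Proof. by rewrite /lebesgue_rV_step /pushforward measure_ge0. Qed.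

Let step_sigma_additive : semi_sigma_additive lebesgue_rV_step.
Proof.
move=> F mF tF mUF.
have mp B : measurable B -> measurable (@rV_cons n @^-1` B).
  by move=> mB; rewrite -[X in measurable X]setTI; exact: measurable_rV_cons.
rewrite /lebesgue_rV_step /pushforward preimage_bigcup.
apply: measure_semi_sigma_additive.
- by move=> i; exact: mp.
- apply/trivIsetP => /= i j _ _ ij; rewrite -preimage_setI.
  by move/trivIsetP : tF => /(_ _ _ _ _ ij) ->//; rewrite preimage_set0.
- by rewrite -preimage_bigcup; exact: mp.
Qed.

HB.instance Definition _ := isMeasure.Build _ _ _ lebesgue_rV_step
  step0 step_ge0 step_sigma_additive.

Let step_sigma_finite : sigma_finite setT lebesgue_rV_step.
Proof.
have [F TF mF] : sigma_finite setT (@lebesgue_measure R \x mu)%E.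
  exact: sigma_finite_prod.
exists (fun k => @rV_uncons n @^-1` F k).
  by rewrite -preimage_bigcup -TF preimage_setT.
move=> k; have [mFk Fkoo] := mF k; split.
  by rewrite -[X in measurable X]setTI; exact: measurable_rV_uncons.
rewrite /lebesgue_rV_step /pushforward -comp_preimage.
by rewrite (_ : _ \o _ = id)//; apply/funext => z; exact: rV_consK.
Qed.

HB.instance Definition _ := Measure_isSigmaFinite.Build _ _ _ lebesgue_rV_step
  step_sigma_finite.

End step.

(* n-fold product of one-dimensional Lebesgue measure; see lebesgue_rV_box. *)
Fixpoint lebesgue_rV (n : nat) : {sigma_finite_measure set 'rV[R]_n -> \bar R} :=
  match n with
  | 0 => @dirac _ 'rV[R]_0 (0 : 'rV[R]_0) R
  | m.+1 => lebesgue_rV_step (lebesgue_rV m)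
  end.

Lemma lebesgue_rV_box n (A : 'I_n -> set (measurableTypeR R)) :
  (forall i, measurable (A i)) ->
  lebesgue_rV n [set x | forall i, A i (x ord0 i)] =
  (\prod_(i < n) lebesgue_measure (A i))%E.
Proof.
elim: n A => [|n ih] A mA.
  rewrite big_ord0 /= diracE mem_set//= => -[]//.
rewrite big_ord_recl -ih => [|i]; last exact: mA.
rewrite /= /lebesgue_rV_step /pushforward.
set B := [set x : 'rV[R]_n | forall i, A (lift ord0 i) (x ord0 i)].
have mB : measurable B.
  rewrite (_ : B = \bigcap_(i in setT) (rV_coord i @^-1` A (lift ord0 i))).
    apply: fin_bigcap_measurable => // i _; rewrite -[X in measurable X]setTI.
    exact: measurable_rV_coord.
  by apply/seteqP; split => x h i; [move=> _|]; exact: h.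
rewrite -product_measure1E//.
congr (_ _); apply/seteqP; split => -[t v] /=.
- move=> h; split; first by have := h ord0; rewrite rV_cons_ord0.
  by move=> i; have := h (lift ord0 i); rewrite rV_cons_lift.
- move=> [h0 h] i; case: (unliftP ord0 i) => [j ->|->].
    by rewrite rV_cons_lift.
  by rewrite rV_cons_ord0.
Qed.

End lebesgue_rV.

Section smooth.
Context {R : realType} {N : nat}.
Implicit Types u : 'rV[R]_N -> R.

(* The norm of 'rV[R]_N in the library is the sup norm. *)
Definition enorm (v : 'rV[R]_N) : R := Num.sqrt (\sum_(i < N) v ord0 i ^+ 2).

Definition partial (i : 'I_N) u : 'rV[R]_N -> R :=
  fun x => 'D_(delta_mx ord0 i) u x.

Definition grad u (x : 'rV[R]_N) : 'rV[R]_N := \row_(i < N) partial i u x.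

(* Iterated partial derivatives of all orders exist and are continuous. *)
Definition smooth u := forall s : seq 'I_N,
  continuous (foldr partial u s) /\
  forall i x, derivable (foldr partial u s) x (delta_mx ord0 i).

Definition compactly_supported u := compact (closure [set x | u x != 0]).

End smooth.

Definition marcinkiewicz_norm d (T : measurableType d) (R : realType)
    (mu : {measure set T -> \bar R}) (p : R) (f : T -> R) : \bar R :=
  (ereal_sup [set (l `^ p)%:E * mu [set z | (l <= `|f z|)%R]
             | l in [set l : R | (0 < l)%R]] `^ p^-1)%E.

(* Main.v *)
Require Import Defs.
From HB Require Import structures.
From mathcomp Require Import all_boot all_order all_algebra.
From mathcomp Require Import all_classical all_reals all_analysis.
From mathcomp Require Import measurable_realfun ess_sup_inf ring.

Set Implicit Arguments.
Unset Strict Implicit.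
Unset Printing Implicit Defensive.

Import Order.TTheory GRing.Theory Num.Theory.
Import numFieldNormedType.Exports.

Local Open Scope classical_set_scope.
Local Open Scope ring_scope.

(* Since |u x - u y|^p <= (2 M)^(p - 1) |u x - u y| with M the sup norm of u,
   the inequality reduces to the weak-type bound, for p = 1,
   |{(x, h) : c |h|^(N+1) <= |u (x + h) - u x|}| <= C c^-1 ||grad u||_1.
   Going from x to x + h along the coordinate axes, one of the N increments is
   at least (c / N) |h|^(N+1), and a shear that preserves the measure moves the
   starting point of that increment back to x.  It remains to bound
   {(x, h) : c |h|^(N+1) <= |u (x + h_i e_i) - u x|}.  On a line parallel to e_i,
   any such (t, h) gives an interval of radius |h| around t on which |d_i u| has
   integral at least c |h|^(N+1).  Vitali's lemma selects disjoint intervals, of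
   radii r_k, such that every (t, h) has t in the 5-fold dilation of one of them
   and |h| <= 2 r_k; the measure of these pairs is at most
   C sum_k r_k^(N+1) <= C c^-1 sum_k int_(J_k) |d_i u|.
   Throughout, |h| is the sup norm, which is at most the Euclidean norm. *)

(** * The Borel structure of row vectors and invariance of Lebesgue measure *)

Section measurable_rV_theory.
Context {R : realType}.
Implicit Types n : nat.

Lemma measurable_rV_forall n (A : 'I_n -> set (measurableTypeR R)) :
  (forall i, measurable (A i)) ->
  measurable [set x : 'rV[R]_n | forall i, A i (x ord0 i)].
Proof.
move=> mA.
rewrite (_ : [set _ | _] = \bigcap_(i in setT) (rV_coord i @^-1` A i)).
  apply: fin_bigcap_measurable => // i _; rewrite -[X in measurable X]setTI.
  exact: measurable_rV_coord.
by apply/seteqP; split => x h i; [move=> _|]; exact: h.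
Qed.

Lemma rV_ballE n (x : 'rV[R]_n) e : 0 < e ->
  ball x e = [set y | forall i, ball (x ord0 i) e (y ord0 i)].
Proof.
move=> e0; apply/seteqP; split => y; first by move=> [_ h] i; exact: h.
by move=> h; split => // i j; rewrite (ord1 i); exact: h.
Qed.

Lemma measurable_rV_ball n (x : 'rV[R]_n) e : 0 < e -> measurable (ball x e).
Proof.
move=> e0; rewrite rV_ballE//.
apply: (measurable_rV_forall (A := fun i => ball (x ord0 i) e)) => i.
exact: measurable_ball.
Qed.

Lemma lebesgue_rV_ball n (x : 'rV[R]_n) e : 0 < e ->
  lebesgue_rV n (ball x e) = ((e *+ 2) ^+ n)%:E.
Proof.
move=> e0.
rewrite rV_ballE// (lebesgue_rV_box (A := fun i => ball (x ord0 i) e)).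
  under eq_bigr do rewrite lebesgue_measure_ball ?ltW//.
  by rewrite prodEFin prodr_const card_ord.
by move=> i; exact: measurable_ball.
Qed.

(** The balls contained in [U] with rational centre and radius [1 / (k + 1)] are countably many, and
    each is a box. They cover [U]: if [ball x e] lies in [U], any such ball of radius less than
    [e / 2] that contains [x] lies in [U] too. *)
Lemma open_measurable_rV n (U : set 'rV[R]_n) : open U -> measurable U.
Proof.
move=> oU.
pose q (a : 'rV[rat]_n) : 'rV[R]_n := map_mx ratr a.
pose B (a : 'rV[rat]_n * nat) := ball (q a.1) a.2.+1%:R^-1.
pose F a := if `[< B a `<=` U >] then B a else set0.
have mF a : measurable (F a).
  by rewrite /F; case: asboolP => // _; exact: measurable_rV_ball.
rewrite (_ : U = \bigcup_a F a).
  by apply: countable_bigcupT_measurable => //; exact: countableP.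
apply/seteqP; split => x; last first.
  by move=> [a _]; rewrite /F; case: asboolP => // + Bx; exact.
move=> Ux; have /nbhs_ballP[e /= e0 xeU] : nbhs x U by exact: open_nbhs_nbhs.
have e20 : 0 < e / 2 by rewrite divr_gt0.
pose k := Num.truncn (e / 2)^-1.
have ke : k.+1%:R^-1 < e / 2.
  rewrite -[ltRHS]invrK ltf_pV2 ?posrE ?invr_gt0//.
  by rewrite truncnS_gt.
have k0 : 0 < k.+1%:R^-1 :> R by rewrite invr_gt0.
have aP i : exists c : rat, ball (x ord0 i) k.+1%:R^-1 (ratr c).
  have [|c] := @rat_in_itvoo R (x ord0 i - k.+1%:R^-1) (x ord0 i + k.+1%:R^-1).
    by rewrite ltrD2l (lt_trans _ k0)// oppr_lt0.
  by rewrite in_itv/= => xc; exists c; rewrite /ball/= ltr_distlC.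
have [c cP] := choice aP.
have Bx : B (\row_i c i, k) x.
  rewrite /B /= rV_ballE// => i; apply: ball_sym; rewrite !mxE; exact: cP.
exists (\row_i c i, k) => //; rewrite /F; case: asboolP => // -[].
move=> y By; apply: xeU; rewrite [e]splitr.
apply: ball_triangle; last exact: (le_ball (ltW ke) By).
exact/(le_ball (ltW ke))/ball_sym.
Qed.

Lemma ler_rV_coord n (x : 'rV[R]_n) i : `|x ord0 i| <= `|x|.
Proof.
rewrite [leRHS]mx_normrE.
exact: (le_bigmax _ (fun ij => `|x ij.1 ij.2|) (ord0, i)).
Qed.

Lemma continuous_measurable_rV n (u : 'rV[R]_n -> R) :
  continuous u -> measurable_fun setT u.
Proof.
move=> /continuousP cu; apply: (measurability _ (RGenOpens.measurableE R)).
move=> _ [_ [a [b ->] <-]]; rewrite setTI; apply: open_measurable_rV.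
exact/cu/interval_open.
Qed.

Lemma measurable_rV_add d (T : measurableType d) n (f g : T -> 'rV[R]_n) :
  measurable_fun setT f -> measurable_fun setT g ->
  measurable_fun setT (fun t => f t + g t).
Proof.
move=> mf mg; apply: measurable_fun_rV => i.
rewrite (_ : _ \o _ = (@rV_coord R n i \o f) \+ (@rV_coord R n i \o g)).
  by apply: measurable_funD; apply: measurableT_comp => //;
    exact: measurable_rV_coord.
by apply/funext => t; rewrite /= /rV_coord mxE.
Qed.

Lemma measurable_rV_opp d (T : measurableType d) n (f : T -> 'rV[R]_n) :
  measurable_fun setT f -> measurable_fun setT (fun t => - f t).
Proof.
move=> mf; apply: measurable_fun_rV => i.
rewrite (_ : _ \o _ = \- (@rV_coord R n i \o f)).
  by apply: measurableT_comp => //; apply: measurableT_comp => //;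
    exact: measurable_rV_coord.
by apply/funext => t; rewrite /= /rV_coord mxE.
Qed.

Lemma measurable_rV_scale d (T : measurableType d) n (f : T -> measurableTypeR R)
    (v : 'rV[R]_n) :
  measurable_fun setT f -> measurable_fun setT (fun t => f t *: v).
Proof.
move=> mf; apply: measurable_fun_rV => i.
rewrite (_ : _ \o _ = (fun t => f t * v ord0 i)).
  exact: measurable_funM.
by apply/funext => t; rewrite /= /rV_coord mxE.
Qed.

End measurable_rV_theory.

Section translation.
Context {R : realType}.
Local Open Scope ereal_scope.

Lemma measurable_preimage d1 d2 (T1 : measurableType d1) (T2 : measurableType d2)
    (f : T1 -> T2) (A : set T2) :
  measurable_fun setT f -> measurable A -> measurable (f @^-1` A).
Proof. by move=> mf mA; rewrite -[X in measurable X]setTI; exact: mf. Qed.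

Lemma measurable_set_bool d (T : measurableType d) (b : T -> bool) :
  measurable_fun setT b -> measurable [set x | b x].
Proof.
move=> mb; rewrite (_ : [set x | b x] = b @^-1` [set true]).
  exact: measurable_preimage.
by apply/seteqP; split => x /=; case: (b x).
Qed.

Lemma ge0_integral_measure_preserving d1 d2 (T1 : measurableType d1)
    (T2 : measurableType d2) (m1 : {measure set T1 -> \bar R})
    (m2 : {measure set T2 -> \bar R}) (f : T1 -> T2) (g : T2 -> \bar R) :
  measurable_fun setT f ->
  (forall A, measurable A -> m1 (f @^-1` A) = m2 A) ->
  measurable_fun setT g -> (forall y, 0 <= g y) ->
  \int[m1]_x g (f x) = \int[m2]_y g y.
Proof.
move=> mf fE mg g0.
transitivity (\int[pushforward m1 f]_y g y).
  by rewrite ge0_integral_pushforward.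
by apply: eq_measure_integral => A mA _; exact: fE.
Qed.

(** By uniqueness of Lebesgue measure: the pushforward under the translation gives each half-open
    interval its length. *)
Lemma lebesgue_measure_translate (a : R) (A : set (measurableTypeR R)) :
  measurable A ->
  lebesgue_measure ((fun x : measurableTypeR R => (x + a)%R) @^-1` A) =
  lebesgue_measure A.
Proof.
have mT : measurable_fun setT
    (fun x : measurableTypeR R => (x + a)%R : measurableTypeR R).
  exact: measurable_funD.
move=> mA; apply/esym.
apply: (@lebesgue_measure_unique _ (pushforward (@lebesgue_measure R)
  (fun x : measurableTypeR R => (x + a)%R : measurableTypeR R))) => //=.
move=> _ [[b c]] _ <-; rewrite /pushforward/=.
rewrite (_ : _ @^-1` _ = `](b - a)%R, (c - a)%R]%classic); last first.
  by apply/seteqP; split => x /=; rewrite !in_itv/= ltrBlDr lerBrDr.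
rewrite !lebesgue_measure_itv/= !lte_fin ltrD2r; case: ifPn => // _.
by rewrite -!EFinB opprB addrA subrK.
Qed.

Lemma rV_consD n (t : R) (x : 'rV[R]_n) (v : 'rV[R]_n.+1) :
  (rV_cons (t, x) + v =
   rV_cons ((t + (rV_uncons v).1)%R : R, (x + (rV_uncons v).2)%R))%R.
Proof.
apply/rowP => i; rewrite mxE; case: (unliftP ord0 i) => [j ->|->].
  rewrite !rV_cons_lift !mxE; congr (_ + v _ _)%R; exact/val_inj.
by rewrite !rV_cons_ord0.
Qed.

(** Induction on the dimension, slicing along the first coordinate: the induction hypothesis
    translates each slice, and one-dimensional invariance handles the integral over the slices. *)
Lemma lebesgue_rV_translate n (v : 'rV[R]_n) (A : set 'rV[R]_n) :
  measurable A -> lebesgue_rV n ((fun x => x + v)%R @^-1` A) = lebesgue_rV n A.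
Proof.
elim: n v A => [|n ih] v A mA.
  rewrite (_ : (fun x => x + v)%R = id) ?preimage_id//.
  by apply/funext => x; rewrite [LHS]thinmx0 [RHS]thinmx0.
rewrite /= /lebesgue_rV_step /pushforward.
pose B := @rV_cons R n @^-1` A.
have mB : measurable B.
  exact: measurable_preimage (@measurable_rV_cons R n) mA.
rewrite /product_measure1 -/B.
rewrite -(@ge0_integral_measure_preserving _ _ _ _ lebesgue_measure
  lebesgue_measure
  (fun x : measurableTypeR R => (x + (rV_uncons v).1)%R : measurableTypeR R)
  (lebesgue_rV n \o xsection B)).
- apply: eq_integral => t _ /=.
  rewrite -(ih (rV_uncons v).2 (xsection B _)); last exact: measurable_xsection.
  congr (lebesgue_rV n _).
  by apply/seteqP; split => x; rewrite /xsection/= !inE /B/= rV_consD.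
- exact: measurable_funD.
- exact: lebesgue_measure_translate.
- exact: measurable_fun_xsection.
- by move=> t; exact: measure_ge0.
Qed.

Lemma ge0_integral_rV_translate n (v : 'rV[R]_n) (g : 'rV[R]_n -> \bar R) :
  measurable_fun setT g -> (forall x, 0 <= g x) ->
  \int[lebesgue_rV n]_x g (x + v)%R = \int[lebesgue_rV n]_x g x.
Proof.
move=> mg g0; apply: ge0_integral_measure_preserving => //.
  apply: measurable_rV_add => //; exact: measurable_cst.
exact: lebesgue_rV_translate.
Qed.

(** Allows slicing with the second component fixed, as a shear of the first component requires. *)
Lemma product_measure12 d1 d2 (T1 : measurableType d1) (T2 : measurableType d2)
    (m1 : {sigma_finite_measure set T1 -> \bar R})
    (m2 : {sigma_finite_measure set T2 -> \bar R}) (A : set (T1 * T2)) :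
  measurable A -> (m1 \x m2) A = (m1 \x^ m2) A.
Proof.
move=> mA; apply: product_measure_unique => // B C mB mC.
by rewrite /= product_measure2E.
Qed.

(** For fixed second component [h], the shear is the translation by [phi h]. *)
Lemma lebesgue_rV_shear_left n (phi : 'rV[R]_n -> 'rV[R]_n)
    (A : set ('rV[R]_n * 'rV[R]_n)) :
  measurable_fun setT phi -> measurable A ->
  (lebesgue_rV n \x lebesgue_rV n) [set z | A ((z.1 + phi z.2)%R, z.2)] =
  (lebesgue_rV n \x lebesgue_rV n) A.
Proof.
move=> mphi mA.
rewrite !product_measure12//; last first.
  apply: (@measurable_preimage _ _ _ _
    (fun z : 'rV[R]_n * 'rV[R]_n => ((z.1 + phi z.2)%R, z.2))) => //.
  apply/measurable_fun_pairP; split; last exact: measurable_snd.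
  apply: measurable_rV_add; first exact: measurable_fst.
  by apply: measurableT_comp => //; exact: measurable_snd.
rewrite /product_measure2; apply: eq_integral => h _ /=.
rewrite -(lebesgue_rV_translate (phi h) (A := ysection A h));
  last exact: measurable_ysection.
by congr (lebesgue_rV n _); apply/seteqP; split => x; rewrite /ysection/= !inE.
Qed.

(** The change of variables [h = y - x], a translation of [y] for each fixed [x]. *)
Lemma lebesgue_rV_sub_right n (A : set ('rV[R]_n * 'rV[R]_n)) :
  measurable A ->
  (lebesgue_rV n \x lebesgue_rV n) [set z | A (z.1, (z.2 - z.1)%R)] =
  (lebesgue_rV n \x lebesgue_rV n) A.
Proof.
move=> mA; rewrite /product_measure1; apply: eq_integral => x _ /=.
rewrite -(lebesgue_rV_translate (- x)%R (A := xsection A x));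
  last exact: measurable_xsection.
by congr (lebesgue_rV n _); apply/seteqP; split => y; rewrite /xsection/= !inE.
Qed.

End translation.

(** * The one-dimensional covering argument *)

Section vitali_weak_type.
Context {R : realType}.
Local Open Scope ereal_scope.

Lemma vitali_weak_type n (f : R -> \bar R) (c r : R)
    (G : set (measurableTypeR R * 'rV[R]_n)) :
  (0 < c)%R -> (0 < r)%R ->
  measurable_fun setT f -> (forall t, 0 <= f t) -> measurable G ->
  (forall t h, G (t, h) -> [/\ (`|t| <= r)%R, (0 < `|h|)%R, (`|h| <= r)%R &
    (c * `|h| ^+ n.+1)%:E <=
      \int[lebesgue_measure]_(s in closed_ball t `|h|) f s]) ->
  (lebesgue_measure \x lebesgue_rV n) G <=
  (c^-1 * (10 * 6 ^+ n))%:E *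
    \int[lebesgue_measure]_(s in closed_ball 0%R (r *+ 2)) f s.
Proof.
move=> c0 r0 mf f0 mG GP.
pose I := (R * {posnum R})%type.
pose B (i : I) : set R := ball i.1 i.2%:num.
pose V := [set i : I | exists h, G (i.1, h) /\ i.2%:num = `|h|%R].
have radB i : (radius (B i))%:num = i.2%:num by rewrite radius_ball_num.
have cB i : closure (B i) = closed_ball i.1 i.2%:num by rewrite closure_ballE.
have [D [cD DV tD maxD]] : {D : set I | [/\ countable D, D `<=` V,
    trivIset D (closure \o B) & forall i, V i -> exists j, [/\ D j,
    closure (B i) `&` closure (B j) !=set0,
    ((radius (B i))%:num / 2 <= (radius (B j))%:num)%R &
    closure (B i) `<=` closure (5%R *` B j)]]}.
  apply: (@vitali_lemma_infinite _ _ B V r) => [i|i|i].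
  - exact: is_ball_ball.
  - by rewrite radB.
  - by move=> [h [/GP[_ _ hr _] ih]]; rewrite radB ih.
have /countable_injP[g ginj] := cD.
(* The injection [g] turns the selected family into a sequence: [E k] holds the index coded by [k],
   if there is one, so [J k] and [S k] below are empty or come from a single interval. *)
pose E k := D `&` g @^-1` [set k].
have E01 k : E k = set0 \/ exists i, D i /\ E k = [set i].
  have [->|/set0P[i [Di gi]]] := eqVneq (E k) set0; [by left|right].
  exists i; split => //; apply/seteqP; split => [j [Dj gj]|_ ->]; last by split.
  by apply: ginj; rewrite ?inE// gi gj.
pose J k := \bigcup_(i in E k) closure (B i).
(* The selection gives [|h| <= 2 r_k]; the radius [3 r_k] leaves room for the strict inequality of
   an open ball. *)
pose S k := \bigcup_(i in E k) (closed_ball i.1 (5 * i.2%:num)%R `*`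
  ball (0%R : 'rV[R]_n) (3 * i.2%:num)).
have mS k : measurable (S k).
  rewrite /S; case: (E01 k) => [->|[i [_ ->]]].
    by rewrite bigcup_set0.
  rewrite bigcup_set1; apply: measurableX; first exact: measurable_closed_ball.
  exact: measurable_rV_ball.
have mJ k : measurable (J k).
  rewrite /J; case: (E01 k) => [->|[i [_ ->]]].
    by rewrite bigcup_set0.
  by rewrite bigcup_set1 cB; exact: measurable_closed_ball.
have GS : G `<=` \bigcup_k S k.
  move=> [t h] Gth; have [_ h0 _ _] := GP _ _ Gth.
  have [|j [Dj _]] := maxD (t, PosNum h0); first by exists h.
  move=> + tj.
  rewrite [X in (X / _ <= _)%R]radB [X in (_ <= X)%R]radB => hj.
  exists (g j); first by [].
  exists j; first exact: conj Dj erefl.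
  split.
    have := tj t; rewrite cB scale_ballE// closure_ballE; apply.
    by rewrite closed_ballE//= /closed_ball_ /= subrr normr0 ltW.
  rewrite -ball_normE /ball_/= sub0r normrN.
  rewrite ler_pdivrMr// in hj; rewrite (le_lt_trans hj)// mulrC ltr_pM2r//.
  by rewrite ltr_nat.
(* The dilated interval has length [10 r_k] and the ball has side [6 r_k], whence the constant
   [10 * 6 ^ n] in front of [r_k ^ (n + 1)]. Selected indices come from [G], so its hypothesis
   bounds [c r_k ^ (n + 1)] by the integral over [J k]. *)
have SJ k : (lebesgue_measure \x lebesgue_rV n) (S k) <=
    (c^-1 * (10 * 6 ^+ n))%:E * \int[lebesgue_measure]_(s in J k) f s.
  rewrite /S /J; case: (E01 k) => [->|[i [/DV[h [/GP[_ _ _ ch] ih] ->]]]].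
    by rewrite !bigcup_set0 measure0 integral_set0 mule0.
  rewrite !bigcup_set1 cB product_measure1E; [|exact: measurable_closed_ball|
    exact: measurable_rV_ball].
  rewrite [X in X * _ <= _](_ : _ = (5 * i.2%:num *+ 2)%:E); last first.
    by apply: lebesgue_measure_closed_ball; rewrite mulr_ge0.
  rewrite lebesgue_rV_ball// -ih in ch *.
  apply: (@le_trans _ _ ((c^-1 * (10 * 6 ^+ n))%:E *
      (c * i.2%:num ^+ n.+1)%:E)); last first.
    by rewrite lee_pmul2l// lte_fin !mulr_gt0 ?invr_gt0 ?exprn_gt0.
  rewrite -!EFinM lee_fin.
  have -> : (3 * i.2%:num *+ 2 = 6 * i.2%:num :> R)%R by ring.
  rewrite exprMn exprS le_eqVlt; apply/orP; left; apply/eqP.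
  by field; rewrite gt_eqF.
(* Centres satisfy [|t| <= r] and radii are at most [r]. *)
have JP k : J k `<=` closed_ball 0%R (r *+ 2).
  move=> s [i [/DV[h [/GP[tr h0 hr _]]]] ih _].
  rewrite cB !closed_ballE ?mulrn_wgt0// /closed_ball_/= ih sub0r normrN => si.
  rewrite -(subrK i.1 s) (le_trans (ler_normD _ _))// mulr2n lerD// distrC.
  exact: le_trans hr.
apply: le_trans; first exact: (measure_sigma_subadditive
  (lebesgue_measure \x lebesgue_rV n) mS mG GS).
apply: (@le_trans _ _ (\sum_(0 <= k <oo) (c^-1 * (10 * 6 ^+ n))%:E *
    \int[lebesgue_measure]_(s in J k) f s)).
  by apply: lee_nneseries => // k _; exact: SJ.
rewrite nneseriesZl => [|k _]; last exact: integral_ge0.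
rewrite lee_pmul2l ?lte_fin ?mulr_gt0 ?invr_gt0 ?exprn_gt0//.
rewrite -ge0_integral_bigcup//.
- apply: ge0_subset_integral => //.
  + exact: bigcupT_measurable.
  + exact: measurable_closed_ball.
  + exact: measurable_funTS.
  + by move=> s [k _ /JP].
- exact: measurable_funTS.
- apply/trivIsetP => k l _ _ kl; apply/seteqP; split => // s.
  move=> [[i [Di /= gi] si] [j [Dj /= gj] sj]].
  move/trivIsetP : tD => /(_ i j Di Dj).
  have ij : i != j by apply: contraNneq kl => ij; rewrite -gi -gj ij.
  by move=> /(_ ij)/seteqP[+ _] => /(_ s); apply.
Qed.

End vitali_weak_type.

(** * Increments along a coordinate axis *)

(* Averaging over the translates x + t v, |t| <= r, replaces the integration
   over lines parallel to v: by translation invariance no coordinate has to be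
   singled out in lebesgue_rV. *)
Section average.
Context {R : realType}.
Local Open Scope ereal_scope.
Variables (n : nat) (v : 'rV[R]_n) (r : R) (g : 'rV[R]_n -> \bar R).
Hypotheses (r0 : (0 < r)%R) (mg : measurable_fun setT g)
  (g0 : forall x, 0 <= g x).

Let D : set (measurableTypeR R) := closed_ball (0 : R)%R r.

Let mD : measurable D. Proof. exact: measurable_closed_ball. Qed.

(** Extended by zero off [|t| <= r], so that Tonelli's theorem applies on the whole product. *)
Let F (z : 'rV[R]_n * measurableTypeR R) :=
  ((fun z => g (z.1 + z.2 *: v)%R) \_ (setT `*` D)) z.

Let F0 z : 0 <= F z. Proof. by rewrite /F patchE; case: ifP. Qed.

Let mF : measurable_fun setT F.
Proof.
apply/(measurable_restrictT _ _).1; first exact: measurableX.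
apply: measurable_funTS; apply: measurableT_comp => //.
apply: measurable_rV_add; first exact: measurable_fst.
by apply: measurable_rV_scale; exact: measurable_snd.
Qed.

Let FE x : \int[lebesgue_measure]_(t in D) g (x + t *: v)%R =
  \int[lebesgue_measure]_t F (x, t).
Proof.
rewrite integral_mkcond; apply: eq_integral => t _.
by rewrite /F !patchE in_setX in_setT.
Qed.

Lemma measurable_line_average : measurable_fun setT
  (fun x : 'rV[R]_n =>
    \int[lebesgue_measure]_(t in closed_ball (0 : R)%R r) g (x + t *: v)%R).
Proof.
under eq_fun do rewrite FE.
exact: measurable_fun_fubini_tonelli_F.
Qed.

Lemma integral_line_average :
  \int[lebesgue_rV n]_x
    (\int[lebesgue_measure]_(t in closed_ball (0 : R)%R r) g (x + t *: v)%R) =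
  (r *+ 2)%:E * \int[lebesgue_rV n]_x g x.
Proof.
under eq_integral do rewrite FE.
rewrite fubini_tonelli//.
transitivity (\int[lebesgue_measure]_(t in D) cst (\int[lebesgue_rV n]_x g x) t).
  rewrite [RHS]integral_mkcond; apply: eq_integral => t _.
  rewrite patchE; case: ifPn => tD; last first.
    by apply: integral0_eq => x _; rewrite /F patchE in_setX in_setT (negbTE tD).
  rewrite -(ge0_integral_rV_translate (t *: v)%R)//.
  by apply: eq_integral => x _; rewrite /F patchE in_setX in_setT tD.
rewrite integral_cst// muleC; congr (_ * _).
by apply: lebesgue_measure_closed_ball; exact: ltW.
Qed.

End average.

Section directional.
Context {R : realType} {n : nat}.
Variables (u : 'rV[R]_n -> R) (i : 'I_n).
Hypotheses (cu : continuous u) (du : forall x, derivable u x (delta_mx ord0 i))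
  (cpu : continuous (partial i u)).
Local Notation e := (delta_mx ord0 i : 'rV[R]_n).

Let quotientE x (t : R) :
  (fun h : R => h^-1 *: (u (x + (h *: (1 : R) + t) *: e) - u (x + t *: e))) =
  (fun h : R => h^-1 *: (u (h *: e + (x + t *: e)) - u (x + t *: e))).
Proof.
apply/funext => h; congr (_ *: (u _ - _)).
by rewrite scalerDl scaler1 addrCA.
Qed.

Lemma derivable_line x (t : R) : derivable (fun s : R => u (x + s *: e)) t 1.
Proof. by rewrite /derivable quotientE; exact: du. Qed.

Lemma derive1_line x (t : R) :
  derive1 (fun s : R => u (x + s *: e)) t = partial i u (x + t *: e).
Proof. by rewrite derive1E /derive quotientE. Qed.

Lemma continuous_line x (w : 'rV[R]_n -> R) : continuous w ->
  continuous (fun s : R => w (x + s *: e)).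
Proof.
move=> cw t; apply: (@continuous_comp _ _ _ (fun s : R => x + s *: e) w).
  apply: cvgD; first exact: cvg_cst.
  by apply: cvgZl; exact: cvg_id.
exact: cw.
Qed.

Local Open Scope ereal_scope.

(** The fundamental theorem of calculus on the line through [x]; the degenerate case [a = b] is
    treated apart. *)
Lemma increment_le_integral x (a b : R) : (a <= b)%R ->
  `|u (x + b *: e)%R - u (x + a *: e)%R|%:E <=
  \int[lebesgue_measure]_(t in `[a, b]) `|partial i u (x + t *: e)|%:E.
Proof.
rewrite le_eqVlt => /predU1P[<-|ab].
  by rewrite subrr normr0 integral_ge0// => ? _; rewrite lee_fin.
have cphi := @continuous_line x _ cu; have cdphi := @continuous_line x _ cpu.
have mL : measurable_fun setT (fun s : R => partial i u (x + s *: e)%R).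
  exact: continuous_measurable_fun.
rewrite -abse_EFin EFinB.
rewrite -(@continuous_FTC2 R (fun s => partial i u (x + s *: e)%R)
  (fun s => u (x + s *: e)%R) a b ab).
- apply: le_trans; first apply: le_abse_integral => //.
    by apply/measurable_EFinP; exact: measurable_funTS.
  exact: lexx.
- exact: continuous_subspaceT.
- split.
  + by move=> t _; exact: derivable_line.
  + by apply: cvg_at_right_filter; exact: cphi.
  + by apply: cvg_at_left_filter; exact: cphi.
- by move=> t _; exact: derive1_line.
Qed.

Lemma measurable_abs_partial_line x :
  measurable_fun setT (fun s : R => `|partial i u (x + s *: e)|%:E).
Proof.
apply/measurable_EFinP; apply: measurableT_comp => //.
by apply: continuous_measurable_fun; apply: continuous_line.
Qed.

Lemma increment_le_integral_closed_ball x (s t r : R) : (0 < r)%R ->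
  (`|s - t| <= r)%R ->
  `|u (x + s *: e)%R - u (x + t *: e)%R|%:E <=
  \int[lebesgue_measure]_(y in closed_ball t r)
    `|partial i u (x + y *: e)|%:E.
Proof.
move=> r0; rewrite ler_distl closed_ball_itv// => /andP[ts st].
have [le_st|/ltW le_ts] := leP s t.
  rewrite distrC; apply: le_trans (increment_le_integral x le_st) _.
  apply: ge0_subset_integral => //.
    apply: measurable_funTS; exact: measurable_abs_partial_line.
  by apply: subset_itv; rewrite bnd_simp// lerDl ltW.
apply: le_trans (increment_le_integral x le_ts) _.
apply: ge0_subset_integral => //.
  apply: measurable_funTS; exact: measurable_abs_partial_line.
by apply: subset_itv; rewrite bnd_simp// gerBl ltW.
Qed.

(** Only the coordinate [h_i] moves the point, but the threshold involves all of [h], as the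
    splitting of an arbitrary increment demands. At [h = 0] the inequality is trivial and there is
    no interval to select, so this case is excluded. *)
Definition directional_set (c : R) : set ('rV[R]_n * 'rV[R]_n) :=
  [set z : 'rV[R]_n * 'rV[R]_n | (0 < `|z.2|)%R /\
    (c * `|z.2| ^+ n.+1 <= `|u (z.1 + z.2 ord0 i *: e) - u z.1|)%R].

Lemma measurable_directional_set c : measurable (directional_set c).
Proof.
have mn : measurable_fun setT (fun z : 'rV[R]_n * 'rV[R]_n => `|z.2|%R).
  apply: (measurableT_comp (f := fun h : 'rV[R]_n => `|h|%R)).
    apply: continuous_measurable_rV; exact: norm_continuous.
  exact: measurable_snd.
have mu := continuous_measurable_rV cu.
apply: (@measurableI _ _ [set z : 'rV[R]_n * 'rV[R]_n | (0 < `|z.2|)%R]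
  [set z : 'rV[R]_n * 'rV[R]_n |
    (c * `|z.2| ^+ n.+1 <= `|u (z.1 + z.2 ord0 i *: e) - u z.1|)%R]).
  apply: measurable_set_bool; apply: measurable_fun_ltr => //.
apply: measurable_set_bool; apply: measurable_fun_ler.
  by apply: measurable_funM => //; exact: measurable_funX.
apply: measurableT_comp => //; apply: measurable_funB.
  apply: measurableT_comp => //; apply: measurable_rV_add.
    exact: measurable_fst.
  apply: measurable_rV_scale.
  by apply: (measurableT_comp (measurable_rV_coord i)); exact: measurable_snd.
by apply: measurableT_comp => //; exact: measurable_fst.
Qed.

(** The covering bound holds on each line parallel to [e], in a window [|t| <= r]; averaging over
    all lines then makes [r] cancel. The bound [M] serves only to choose [r], and does not enter the
    estimate. *)
Lemma directional_weak_type (c M : R) : (0 < c)%R -> (forall x, `|u x| <= M)%R ->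
  (lebesgue_rV n \x lebesgue_rV n) (directional_set c) <=
  (c^-1 * (20 * 6 ^+ n))%:E * \int[lebesgue_rV n]_x `|partial i u x|%:E.
Proof.
move=> c0 uM; have mA := measurable_directional_set c.
set A := directional_set c in mA *.
have M0 : (0 <= M)%R by exact: le_trans (uM 0%R).
(* If |h| > r >= 1 then c |h|^(n+1) >= c |h| > 2 M. *)
pose r := (1 + M *+ 2 / c)%R.
have r1 : (1 <= r)%R by rewrite lerDl divr_ge0 ?mulrn_wge0// ltW.
have r0 : (0 < r)%R by rewrite (lt_le_trans _ r1).
have Ar x h : A (x, h) -> (`|h| <= r)%R.
  move=> [/= h0 ch]; rewrite leNgt; apply/negP => rh.
  have : (c * `|h| <= M *+ 2)%R.
    apply: (@le_trans _ _ (c * `|h| ^+ n.+1)%R).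
      rewrite ler_pM2l// ler_eXnr// ltW//; exact: le_lt_trans rh.
    by apply: (le_trans ch); rewrite (le_trans (ler_normB _ _))// mulr2n lerD.
  rewrite -ler_pdivlMl// leNgt mulrC => /negP; apply.
  by apply: le_lt_trans rh; rewrite lerDr.
pose m := lebesgue_rV n \o xsection A.
have mm : measurable_fun setT m by exact: measurable_fun_xsection.
have m0 x : 0 <= m x by exact: measure_ge0.
have mP : measurable_fun setT (fun x => `|partial i u x|%:E).
  apply/measurable_EFinP; apply: measurableT_comp => //.
  exact: continuous_measurable_rV.
have key x :
    \int[lebesgue_measure]_(t in closed_ball (0 : R)%R r) m (x + t *: e)%R <=
    (c^-1 * (10 * 6 ^+ n))%:E *
    \int[lebesgue_measure]_(t in closed_ball (0 : R)%R (r *+ 2))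
      `|partial i u (x + t *: e)|%:E.
  (* The part of [A] over the line through [x], parametrized by [t] in the window. *)
  pose G : set (measurableTypeR R * 'rV[R]_n) :=
    (closed_ball (0 : R)%R r `*` setT) `&` [set z | A ((x + z.1 *: e)%R, z.2)].
  have mG : measurable G.
    apply: measurableI.
      apply: measurableX => //; exact: measurable_closed_ball.
    apply: (@measurable_preimage _ _ _ _ (fun z : measurableTypeR R * 'rV[R]_n =>
      ((x + z.1 *: e)%R, z.2))) => //.
    apply/measurable_fun_pairP; split; last exact: measurable_snd.
    apply: measurable_rV_add; first exact: measurable_cst.
    by apply: measurable_rV_scale; exact: measurable_fst.
  apply: le_trans (@vitali_weak_type R n _ c r G c0 r0
    (measurable_abs_partial_line x) _ mG _).
  - rewrite integral_mkcond /product_measure1.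
    rewrite le_eqVlt; apply/orP; left; apply/eqP; apply: eq_integral => t _.
    rewrite patchE /= /m /=; case: ifPn => tD.
      congr (lebesgue_rV n _); apply/seteqP; split => h;
        rewrite /xsection /= !inE//.
      by move=> ?; split => //; split => //=; exact: set_mem.
      by move=> [].
    rewrite (_ : xsection G t = set0) ?measure0//; apply/seteqP; split => // h.
    by rewrite /xsection/= inE => -[[/= /mem_set]]; rewrite (negbTE tD).
  - by move=> t; rewrite lee_fin.
  - move=> t h [[/= tr _] Ath]; have hr := Ar _ _ Ath.
    have [/= h0 ch] := Ath; split => //.
      by move: tr; rewrite closed_ballE// /closed_ball_ /= sub0r normrN.
    (* The increment runs from parameter [t] to [t + h_i], and [|h_i| <= |h|] keeps it inside the
       interval of radius [|h|] around [t]. *)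
    apply: le_trans
      (@increment_le_integral_closed_ball x (t + h ord0 i) t _ h0 _).
      by rewrite lee_fin scalerDl addrA.
    by rewrite addrAC subrr add0r; exact: ler_rV_coord.
(* Integrating [key] over [x] gives a factor [2 r] on the left and [4 r] on the right, where the
   window has radius [2 r]; this turns [10] into [20]. *)
rewrite -(@lee_pmul2l _ (r *+ 2)%:E)// ?lte_fin ?mulrn_wgt0//.
rewrite {1}/product_measure1 -/m -(integral_line_average e r0 mm m0).
have P0 x : 0 <= `|partial i u x|%:E by rewrite lee_fin.
have r20 : (0 < r *+ 2)%R by rewrite mulrn_wgt0.
apply: (@le_trans _ _ (\int[lebesgue_rV n]_x ((c^-1 * (10 * 6 ^+ n))%:E *
    \int[lebesgue_measure]_(t in closed_ball (0 : R)%R (r *+ 2))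
      `|partial i u (x + t *: e)|%:E))).
  apply: ge0_le_integral => //.
  - by move=> x _; apply: integral_ge0.
  - exact: measurable_line_average.
  - by apply: measurable_funeM;
      exact: (@measurable_line_average R n e (r *+ 2)%R _ mP P0).
rewrite ge0_integralZl//.
- rewrite (integral_line_average e r20 mP P0) !muleA -!EFinM.
  rewrite le_eqVlt; apply/orP; left; apply/eqP; congr (_%:E * _).
  by ring.
- exact: (@measurable_line_average R n e (r *+ 2)%R _ mP P0).
- by move=> x _; apply: integral_ge0.
- by rewrite lee_fin !mulr_ge0// ?invr_ge0 ?exprn_ge0// ltW.
Qed.

End directional.

(** * Arbitrary increments *)

Section telescoping.
Context {R : realType}.
Implicit Types n : nat.

(** The corners of the path from [0] to [h] along the coordinate axes. *)
Definition rV_trunc n k (h : 'rV[R]_n) : 'rV[R]_n :=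
  \row_j (if (j < k)%N then h ord0 j else 0).

Lemma rV_trunc0 n (h : 'rV[R]_n) : rV_trunc 0 h = 0.
Proof. by apply/rowP => j; rewrite !mxE. Qed.

Lemma rV_truncT n (h : 'rV[R]_n) : rV_trunc n h = h.
Proof. by apply/rowP => j; rewrite !mxE ltn_ord. Qed.

Lemma rV_truncS n (h : 'rV[R]_n) (i : 'I_n) :
  rV_trunc i.+1 h = rV_trunc i h + h ord0 i *: delta_mx ord0 i.
Proof.
apply/rowP => j; rewrite !mxE eqxx/= ltnS leq_eqVlt.
have [/eqP/val_inj ->|ji] := boolP (j == i :> nat).
  by rewrite eqxx ltnn/= mulr1 add0r.
have /negbTE -> : j != i by apply: contraNneq ji => ->.
by rewrite mulr0 addr0.
Qed.

Lemma measurable_rV_trunc n k : measurable_fun setT (@rV_trunc n k).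
Proof.
apply: measurable_fun_rV => j.
rewrite (_ : _ \o _ = fun h => if (j < k)%N then rV_coord j h else 0).
  case: (j < k)%N; first exact: measurable_rV_coord.
  exact: measurable_cst.
by apply/funext => h; rewrite /= /rV_coord mxE.
Qed.

(** The increments along the path telescope, so they cannot all be smaller than [a / (n + 1)]. *)
Lemma exists_large_increment n (u : 'rV[R]_n.+1 -> R) (x h : 'rV[R]_n.+1) a :
  a <= `|u (x + h) - u x| ->
  exists i : 'I_n.+1, a / n.+1%:R <=
    `|u (x + rV_trunc i h + h ord0 i *: delta_mx ord0 i)
      - u (x + rV_trunc i h)|.
Proof.
move=> au; apply: contrapT => /forallNP small.
move: au; rewrite leNgt => /negP; apply.
have -> : u (x + h) - u x = \sum_(0 <= i < n.+1)
    (u (x + rV_trunc i.+1 h) - u (x + rV_trunc i h)).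
  rewrite (telescope_sumr (fun i => u (x + rV_trunc i h)))//.
  by rewrite rV_truncT rV_trunc0 addr0.
apply: le_lt_trans (ler_norm_sum _ _ _) _.
rewrite [ltRHS](_ : _ = \sum_(0 <= i < n.+1) a / n.+1%:R); last first.
  by rewrite big_mkord sumr_const card_ord -[RHS]mulr_natr divfK.
apply: ltr_sum_nat => // i /= iN.
have /negP := small (Ordinal iN); rewrite -ltNge /=.
by rewrite -addrA -(rV_truncS h (Ordinal iN)).
Qed.

End telescoping.

Section weak_L1.
Context {R : realType} {n : nat}.
Variable u : 'rV[R]_n.+1 -> R.
Hypothesis su : smooth u.
Local Open Scope ereal_scope.

Lemma smooth_continuous : continuous u.
Proof. by have [] := su [::]. Qed.

Lemma smooth_derivable (i : 'I_n.+1) x : derivable u x (delta_mx ord0 i).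
Proof. by have [_] := su [::]; apply. Qed.

Lemma smooth_continuous_partial (i : 'I_n.+1) : continuous (partial i u).
Proof. by have [] := su [:: i]. Qed.

Lemma measurable_enorm : measurable_fun setT (@enorm R n.+1).
Proof.
apply: measurableT_comp.
  by apply: continuous_measurable_fun; exact: sqrt_continuous.
apply: measurable_sum => i; apply: measurable_funX.
exact: measurable_rV_coord.
Qed.

Lemma enorm_ge0 m (v : 'rV[R]_m) : (0 <= enorm v)%R.
Proof. exact: sqrtr_ge0. Qed.

Lemma ler_coord_enorm m (v : 'rV[R]_m) i : (`|v ord0 i| <= enorm v)%R.
Proof.
rewrite -sqrtr_sqr ler_wsqrtr// (bigD1 i)//= lerDl sumr_ge0// => j _.
exact: sqr_ge0.
Qed.

Lemma ler_norm_enorm m (v : 'rV[R]_m) : (`|v| <= enorm v)%R.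
Proof.
rewrite [leLHS]mx_normrE; apply: bigmax_le => [|[i j] _]; first exact: enorm_ge0.
by rewrite /= (ord1 i); exact: ler_coord_enorm.
Qed.

Lemma measurable_enorm_grad :
  measurable_fun setT (fun x => (enorm (grad u x))%:E).
Proof.
apply/measurable_EFinP; apply: (measurableT_comp measurable_enorm).
apply: measurable_fun_rV => i.
rewrite (_ : _ \o _ = partial i u).
  by apply: continuous_measurable_rV; exact: smooth_continuous_partial.
by apply/funext => x; rewrite /= /rV_coord mxE.
Qed.

Definition increment_set (c : R) : set ('rV[R]_n.+1 * 'rV[R]_n.+1) :=
  [set z : 'rV[R]_n.+1 * 'rV[R]_n.+1 | (0 < `|z.2|)%R /\
    (c * `|z.2| ^+ n.+2 <= `|u (z.1 + z.2) - u z.1|)%R].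

Lemma measurable_increment_set c : measurable (increment_set c).
Proof.
have mn : measurable_fun setT (fun z : 'rV[R]_n.+1 * 'rV[R]_n.+1 => `|z.2|%R).
  apply: (measurableT_comp (f := fun h : 'rV[R]_n.+1 => `|h|%R)).
    apply: continuous_measurable_rV; exact: norm_continuous.
  exact: measurable_snd.
have mu := continuous_measurable_rV smooth_continuous.
apply: (@measurableI _ _ [set z : 'rV[R]_n.+1 * 'rV[R]_n.+1 | (0 < `|z.2|)%R]
  [set z : 'rV[R]_n.+1 * 'rV[R]_n.+1 |
    (c * `|z.2| ^+ n.+2 <= `|u (z.1 + z.2) - u z.1|)%R]).
  by apply: measurable_set_bool; apply: measurable_fun_ltr.
apply: measurable_set_bool; apply: measurable_fun_ler.
  by apply: measurable_funM => //; exact: measurable_funX.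
apply: measurableT_comp => //; apply: measurable_funB.
  apply: measurableT_comp => //; apply: measurable_rV_add.
    exact: measurable_fst.
  exact: measurable_snd.
by apply: measurableT_comp => //; exact: measurable_fst.
Qed.

Lemma increment_weak_type (c M : R) : (0 < c)%R -> (forall x, `|u x| <= M)%R ->
  (lebesgue_rV n.+1 \x lebesgue_rV n.+1) (increment_set c) <=
  (c^-1 * (20 * 6 ^+ n.+1 * n.+1%:R ^+ 2))%:E *
    \int[lebesgue_rV n.+1]_x (enorm (grad u x))%:E.
Proof.
move=> c0 uM; set m := (lebesgue_rV n.+1 \x lebesgue_rV n.+1).
pose c' := (c / n.+1%:R)%R.
have c'0 : (0 < c')%R by rewrite divr_gt0.
(* The pairs whose [k]-th step is large. The starting point of that step is shifted by a function of
   [h] alone, so [B k] is the preimage of a [directional_set] under a shear. *)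
pose B k : set ('rV[R]_n.+1 * 'rV[R]_n.+1) :=
  [set z | directional_set u (inord k) c' ((z.1 + rV_trunc k z.2)%R, z.2)].
have mA k := measurable_directional_set (inord k) smooth_continuous c'.
have mB k : measurable (B k).
  apply: (@measurable_preimage _ _ _ _ (fun z : 'rV[R]_n.+1 * 'rV[R]_n.+1 =>
    ((z.1 + rV_trunc k z.2)%R, z.2))) => //.
  apply/measurable_fun_pairP; split; last exact: measurable_snd.
  apply: measurable_rV_add; first exact: measurable_fst.
  apply: measurableT_comp; last exact: measurable_snd.
  exact: measurable_rV_trunc.
have sub : increment_set c `<=` \big[setU/set0]_(k < n.+1) B k.
  move=> [x h] [/= h0 /exists_large_increment[i ih]].
  rewrite -bigcup_mkord; exists i; first exact: ltn_ord.
  rewrite /B /directional_set/= inord_val; split => //.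
  by rewrite /c' mulrAC.
apply: le_trans; first exact: (content_subadditive m (fun k _ => mB k)
  (measurable_increment_set c) sub).
set I := \int[lebesgue_rV n.+1]_x (enorm (grad u x))%:E.
(* One factor [n + 1] counts the directions, the other comes from [c'^-1 = (n + 1) / c]. *)
apply: (@le_trans _ _ (\sum_(k < n.+1) (c'^-1 * (20 * 6 ^+ n.+1))%:E * I)).
  apply: lee_sum => k _.
  apply: (@le_trans _ _ (m (directional_set u (inord k) c'))).
    rewrite le_eqVlt; apply/orP; left; apply/eqP.
    exact: lebesgue_rV_shear_left (@measurable_rV_trunc R n.+1 k) (mA k).
  apply: le_trans (directional_weak_type smooth_continuous
    (@smooth_derivable (inord k)) (@smooth_continuous_partial (inord k))
    c'0 uM) _.
  rewrite lee_pmul2l ?lte_fin ?mulr_gt0 ?invr_gt0 ?exprn_gt0//.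
  apply: ge0_le_integral => //.
  - apply/measurable_EFinP; apply: measurableT_comp => //.
    by apply: continuous_measurable_rV; exact: smooth_continuous_partial.
  - exact: measurable_enorm_grad.
  - move=> x _; rewrite lee_fin.
    by apply: le_trans (ler_coord_enorm _ (inord k)); rewrite mxE.
rewrite -ge0_sume_distrl => [|k _]; last first.
  by rewrite lee_fin !mulr_ge0// ?invr_ge0 ?exprn_ge0// ltW.
rewrite sumEFin sumr_const card_ord -[X in X%:E * _]mulr_natr.
rewrite le_eqVlt; apply/orP; left; apply/eqP; congr (_%:E * _).
rewrite /c'; field.
by rewrite gt_eqF//= pnatr_eq0.
Qed.

End weak_L1.

(** * From the weak-type bound to the Marcinkiewicz norm *)

Section conclusion.
Context {R : realType}.
Implicit Types n : nat.

Lemma compactly_supported_bounded n (u : 'rV[R]_n -> R) :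
  continuous u -> compactly_supported u -> exists B, forall x, `|u x| <= B.
Proof.
move=> cu cptu.
have [B [_ BP]] := compact_bounded (continuous_compact
  (continuous_subspaceT cu) cptu).
exists (`|B| + 1) => x.
have [->|ux] := eqVneq (u x) 0; first by rewrite normr0 addr_ge0.
apply: (BP (`|B| + 1)).
  by rewrite (le_lt_trans (ler_norm B))// ltrDl.
by exists x => //; exact: subset_closure.
Qed.

(** Under this positivity the norm with exponent [+oo] unfolds to the essential supremum. *)
Lemma lebesgue_rV_gt0 n : (0 < lebesgue_rV n [set: 'rV[R]_n])%E.
Proof.
apply: (@lt_le_trans _ _ (lebesgue_rV n (ball (0 : 'rV[R]_n) 1))).
  by rewrite lebesgue_rV_ball// lte_fin exprn_gt0// mulrn_wgt0.
by apply: le_measure; rewrite ?inE//; exact: measurable_rV_ball.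
Qed.

(** By continuity, a point where [|u|] exceeds its essential supremum has a ball of such points
    around it, and a ball is not null. *)
Lemma continuous_Lnorm_oo n (u : 'rV[R]_n -> R) B :
  continuous u -> (forall x, `|u x| <= B) ->
  exists M, [/\ ('N[lebesgue_rV n]_+oo[EFin \o u] = M%:E)%E, 0 <= M &
    forall x, `|u x| <= M].
Proof.
move=> cu uB.
have N0 := @Lnorm_ge0 _ _ _ (lebesgue_rV n) +oo%E (EFin \o u).
have Ness : ('N[lebesgue_rV n]_+oo[EFin \o u] =
    ess_sup (lebesgue_rV n) (abse \o (EFin \o u)))%E.
  by rewrite unlock lebesgue_rV_gt0.
have NB : ('N[lebesgue_rV n]_+oo[EFin \o u] <= B%:E)%E.
  by rewrite Ness; apply/ess_supP; apply: nearW => x /=; rewrite lee_fin.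
have [M NM] : exists M, ('N[lebesgue_rV n]_+oo[EFin \o u] = M%:E)%E.
  exists (fine ('N[lebesgue_rV n]_+oo[EFin \o u])%E).
  rewrite fineK// ge0_fin_numE//.
  by rewrite (le_lt_trans NB)// ltry.
exists M; split => //; first by rewrite -lee_fin -NM.
move=> x; rewrite leNgt; apply/negP => Mux.
have /ess_supP[A [mA A0 AP]] :
    (ess_sup (lebesgue_rV n) (abse \o (EFin \o u)) <= M%:E)%E.
  by rewrite -Ness NM.
have : \forall y \near x, M < `|u y|.
  exact: (cvgr_gt _ (cvg_norm (cu x)) _ Mux).
move=> /nbhs_ballP[e /= e0 xe].
have : (lebesgue_rV n (ball x e) <= lebesgue_rV n A)%E.
  apply: le_measure; rewrite ?inE//; first exact: measurable_rV_ball.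
  move=> y /xe Muy; apply: AP => /=; rewrite lee_fin.
  by apply/negP; rewrite -ltNge.
rewrite A0 lebesgue_rV_ball// lee_fin leNgt => /negP; apply.
by rewrite exprn_gt0// mulrn_wgt0.
Qed.

End conclusion.
Theorem corollary5p1 (R : realType) (N : nat) (hN : (1 <= N)%N) :
  exists C : R, forall (p : R) (u : 'rV[R]_N -> R),
    1 < p -> smooth u -> compactly_supported u ->
    (marcinkiewicz_norm (lebesgue_rV N \x lebesgue_rV N)%E p
       (fun z : 'rV[R]_N * 'rV[R]_N =>
          ((u z.1 - u z.2) / enorm (z.1 - z.2) `^ (N.+1%:R / p))%R)
     <= C%:E
        * 'N[lebesgue_rV N]_+oo[EFin \o u] `^ (1 - p^-1)
        * (\int[lebesgue_rV N]_x (enorm (grad u x))%:E) `^ p^-1)%E.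
Proof.
case: N hN => // n _.
pose K : R := 20 * 6 ^+ n.+1 * n.+1%:R ^+ 2.
have K1 : 1 <= K by rewrite /K !mulr_ege1 ?exprn_ege1 ?ler1n.
(* The [2] absorbs [2 ^ (1 - 1/p)] and, as [K >= 1], [K] absorbs [K ^ (1/p)]; so the constant is
   independent of [p]. *)
exists (2 * K) => p u p1 su cptu.
have cu := smooth_continuous su.
have [B uB] := compactly_supported_bounded cu cptu.
have [M [-> M0 uM]] := continuous_Lnorm_oo cu uB.
have p0 : 0 < p by exact: lt_trans p1.
have pV1 : p^-1 <= 1 by rewrite invf_le1// ltW.
have pV0 : 0 <= p^-1 by rewrite invr_ge0 ltW.
set I := (\int[lebesgue_rV n.+1]_x (enorm (grad u x))%:E)%E.
have I0 : (0 <= I)%E.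
  by apply: integral_ge0 => x _; rewrite lee_fin; exact: enorm_ge0.
pose L := (M *+ 2) `^ (p - 1) * K.
have L0 : 0 <= L by rewrite mulr_ge0 ?powR_ge0// (le_trans _ K1).
apply: (@le_trans _ _ ((L%:E * I) `^ p^-1)%E); last first.
  rewrite poweRM ?lee_fin//; apply: lee_wpmul2r; first exact: poweR_ge0.
  rewrite !poweR_EFin -EFinM lee_fin /L powRM ?powR_ge0 ?(le_trans _ K1)//.
  rewrite -powRrM mulrBl mul1r divff ?gt_eqF// -[M *+ 2]mulr_natl powRM//.
  rewrite mulrAC ler_wpM2r ?powR_ge0// ler_pM ?powR_ge0//.
    by rewrite -[leRHS]powRr1// ler_powR ?ler1n// gerBl.
  by rewrite -[leRHS]powRr1 ?(le_trans _ K1)// ler_powR.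
pose f (z : 'rV[R]_n.+1 * 'rV[R]_n.+1) :=
  (u z.1 - u z.2) / enorm (z.1 - z.2) `^ (n.+2%:R / p).
set m := (lebesgue_rV n.+1 \x lebesgue_rV n.+1)%E.
(* Monotonicity of the [p]-th root is used on nonnegative values; the supremum is nonnegative
   because its term at [l = 1] is. *)
apply: gt0_ler_poweR => //.
- rewrite in_itv/= leey andbT.
  apply: (@le_trans _ _ ((1 `^ p)%:E * m [set z | (1 <= `|f z|)%R])%E).
    by rewrite mule_ge0// lee_fin powR_ge0.
  by apply: ereal_sup_ubound; exists 1; [exact: ltr01|].
- by rewrite in_itv/= leey andbT mule_ge0.
apply: ge_ereal_sup => _ [l /= l0 <-].
(* On the diagonal the quotient takes the default value [0], below [l]. *)
have fP z : (l <= `|f z|) = (0 < enorm (z.1 - z.2)) &&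
    (l * enorm (z.1 - z.2) `^ (n.+2%:R / p) <= `|u z.1 - u z.2|).
  rewrite /f lt_def enorm_ge0 andbT.
  have [->|e0] /= := eqVneq (enorm (z.1 - z.2)) 0.
    by rewrite powR0 ?mulf_neq0 ?invr_eq0 ?gt_eqF// invr0 mulr0 normr0 leNgt l0.
  have eP : 0 < enorm (z.1 - z.2) by rewrite lt_def e0 enorm_ge0.
  by rewrite normrM normfV (ger0_norm (powR_ge0 _ _)) ler_pdivlMr// powR_gt0.
(* The [p]-th power turns the exponent [(N + 1) / p] into [N + 1], with [N = n + 1]; all but one
   power of the increment is bounded by [2 M]. *)
have fE z : l <= `|f z| -> 0 < enorm (z.1 - z.2) /\
    l `^ p * enorm (z.1 - z.2) ^+ n.+2 <= (M *+ 2) `^ (p - 1) * `|u z.1 - u z.2|.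
  rewrite fP => /andP[e0 le]; split => //.
  have uu : `|u z.1 - u z.2| <= M *+ 2.
    by rewrite (le_trans (ler_normB _ _))// mulr2n lerD.
  have -> : l `^ p * enorm (z.1 - z.2) ^+ n.+2 =
      (l * enorm (z.1 - z.2) `^ (n.+2%:R / p)) `^ p.
    rewrite powRM ?powR_ge0 ?(ltW l0)// -powRrM divfK ?gt_eqF//.
    by rewrite powR_mulrn// ltW.
  apply: (@le_trans _ _ (`|u z.1 - u z.2| `^ p)).
    by apply: ge0_ler_powR; rewrite ?nnegrE ?(ltW p0)// mulr_ge0 ?powR_ge0// ltW.
  have -> : `|u z.1 - u z.2| `^ p =
      `|u z.1 - u z.2| `^ (p - 1) * `|u z.1 - u z.2|.
    by rewrite -[X in _ = _ * X]powRr1// -powRD subrK// gt_eqF.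
  rewrite ler_wpM2r//; apply: ge0_ler_powR; rewrite ?nnegrE//.
    by rewrite subr_ge0 ltW.
  by rewrite mulrn_wge0.
have mdiff : measurable_fun setT
    (fun z : 'rV[R]_n.+1 * 'rV[R]_n.+1 => `|u z.1 - u z.2|).
  apply: measurableT_comp => //; apply: measurable_funB.
    apply: measurableT_comp; first exact: continuous_measurable_rV.
    exact: measurable_fst.
  apply: measurableT_comp; first exact: continuous_measurable_rV.
  exact: measurable_snd.
have menorm : measurable_fun setT
    (fun z : 'rV[R]_n.+1 * 'rV[R]_n.+1 => enorm (z.1 - z.2)).
  apply: (measurableT_comp (@measurable_enorm R n)).
  apply: measurable_rV_add; first exact: measurable_fst.
  apply: measurable_rV_opp; exact: measurable_snd.
have mS : measurable [set z | l <= `|f z|].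
  apply: measurable_set_bool; under eq_fun do rewrite fP.
  apply: measurable_and; first exact: measurable_fun_ltr.
  apply: measurable_fun_ler => //; apply: measurable_funM => //.
  exact: (measurableT_comp (measurable_powR _) menorm).
have lp0 : 0 < l `^ p by rewrite powR_gt0.
(* For [M = 0] the definition of [c] below would divide by zero, but then the level set is empty. *)
have [MM|MM] := eqVneq M 0.
  rewrite (_ : [set _ | _] = set0) ?measure0 ?mule0 ?mule_ge0//.
  apply/seteqP; split => // z /fE[e0]; rewrite leNgt => /negP; apply.
  have pm1 : p - 1 != 0 by rewrite subr_eq0 gt_eqF.
  by rewrite MM mul0rn powR0// mul0r mulr_gt0// exprn_gt0.
(* With this [c], [fE] places the level set inside the increment set, and [c^-1 * K] equals [L]
   divided by the factor [l ^ p] of the supremum. *)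
pose c := l `^ p / (M *+ 2) `^ (p - 1).
have D0 : 0 < (M *+ 2) `^ (p - 1).
  by rewrite powR_gt0// mulrn_wgt0// lt_def MM.
have c0 : 0 < c by rewrite divr_gt0.
rewrite -lee_pdivlMl//.
have mT : measurable [set z | increment_set u c (z.1, z.2 - z.1)].
  apply: (@measurable_preimage _ _ _ _ (fun z : 'rV[R]_n.+1 * 'rV[R]_n.+1 =>
    (z.1, z.2 - z.1))); last exact: measurable_increment_set.
  apply/measurable_fun_pairP; split; first exact: measurable_fst.
  apply: measurable_rV_add; first exact: measurable_snd.
  apply: measurable_rV_opp; exact: measurable_fst.
apply: (@le_trans _ _ (m [set z | increment_set u c (z.1, z.2 - z.1)])).
  apply: le_measure; rewrite ?inE//.
  move=> z /= /fE[e0 ez]; split => /=.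
    rewrite normr_gt0 subr_eq0; apply: contraTneq e0 => ->.
    by rewrite subrr /enorm big1 ?sqrtr0 ?ltxx// => i _; rewrite mxE expr0n.
  rewrite [z.1 + _]addrC subrK [`|z.2 - z.1|]distrC [`|u z.2 - _|]distrC.
  rewrite /c mulrAC ler_pdivrMr// [leRHS]mulrC.
  apply: le_trans ez; rewrite ler_pM2l//.
  by rewrite lerXn2r ?nnegrE ?enorm_ge0// ler_norm_enorm.
rewrite /m lebesgue_rV_sub_right; last exact: measurable_increment_set.
apply: le_trans (increment_weak_type su c0 uM) _.
rewrite muleA -EFinM -/I le_eqVlt; apply/orP; left; apply/eqP.
congr (_%:E * _)%E; rewrite /c /L -/K.
by field; rewrite !gt_eqF.
Qed.
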